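(* Let $p>1$ and let $X$ be a $p$-combinatorially Loewner, LLC and metrically doubling (compact) metric space. Then there exists a constant $C>0$ such that for every $r\in(0,\operatorname{diam}(X))$ and every $x\in X$, $$\mathcal H^p(B(x,r))\ge C r^p.$$
   Context: Balls are open: $B(z,r)=\{w: d(z,w)<r\}$, $r>0$. $\mathcal H^p(A)=\lim_{\delta\to0}\mathcal H^p_\delta(A)$, where $\mathcal H^p_\delta(A)=\inf\{\sum_{i\in\mathbb N}\operatorname{diam}(A_i)^p: A\subset\bigcup_i A_i,\ \operatorname{diam}(A_i)\le\delta\}$. A curve is a continuous map from a nonempty compact interval to $X$, identified with its image. $X$ is metrically doubling if there is $D\ge1$ such that every ball $B(z,r)$ can be covered by at most $D$ balls of radius $r/2$. $X$ is LLC if there is $C'\ge 1$ such that any $x,y\in X$ are contained in a curve $\gamma$ with $\operatorname{diam}(\gamma)\le C' d(x,y)$. $\kappa$-approximations. Let $\kappa\ge1$. A finite collection $\mathcal U$ of open sets of $X$, with a chosen point $z_U\in U$ for each $U\in\mathcal U$ and $r_U:=\sup\{d(z_U,x):x\in U\}$, is $\kappa$-round if $B(z_U,\kappa^{-1}r_U)\subset U\subset B(z_U,r_U)$ for each $U\in\mathcal U$. It is a $\kappa$-approximation if moreover it covers $X$, the balls $B(z_U,\kappa^{-1}r_U)$, $U\in\mathcal U$, are pairwise disjoint, and for every $L\ge1$ there is a constant $\kappa_L$ such that $B(z_U,Lr_U)\cap B(z_V,Lr_V)\ne\emptyset$ implies $r_U\le\kappa_L r_V$. It is at level $r$ if $r_U=r$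 for all $U\in\mathcal U$. Discrete modulus. For a collection of curves $\Gamma$, $\mathrm{Mod}_{p,\mathcal U}(\Gamma)=\inf_\rho\sum_{U\in\mathcal U}\rho(U)^p$, the infimum over $\rho:\mathcal U\to[0,\infty)$ with $\sum_{U\in\mathcal U,\,U\cap\gamma\ne\emptyset}\rho(U)\ge1$ for every $\gamma\in\Gamma$. Combinatorial Loewner property. Let $\Gamma(E,F)$ be the collection of curves joining closed sets $E$ and $F$. A continuum is a compact connected set, and $\Delta(E,F)=\frac{d(E,F)}{\min\{\operatorname{diam}(E),\operatorname{diam}(F)\}}$. Let $\mathcal U_k$ ($k\ge0$) be a sequence of $\kappa$-approximations of $X$ at level $2^{-k}$. A compact LLC space $X$ is $p$-combinatorially Loewner ($p>1$) if there are increasing continuous functions $\phi,\psi:(0,\infty)\to(0,\infty)$ with $\lim_{t\to0}\psi(t)=0$ such that: (1) for every pair of disjoint continua $E,F\subset X$ and all $k\ge0$ with $2^{-k}\le\min\{\operatorname{diam}(E),\operatorname{diam}(F)\}$, $\phi(\Delta(E,F)^{-1})\le\mathrm{Mod}_{p,\mathcal U_k}(\Gamma(E,F))$; (2) for every $z\in X$, $0<r<R$ and all $k\ge0$ with $2^{-k}\le r$, $\mathrm{Mod}_{p,\mathcal U_k}(\Gamma(\overline{B(z,r)},X\setminus B(z,R)))\le\psi\left(\frac{r}{R-r}\right)$. *)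

(* Defs.v *)
From HB Require Import structures.
From mathcomp Require Import all_boot all_order all_algebra.
From mathcomp Require Import all_classical all_reals all_analysis.

Set Implicit Arguments.
Unset Strict Implicit.
Unset Printing Implicit Defensive.

Import Order.TTheory GRing.Theory Num.Theory.
Import numFieldNormedType.Exports.

Local Open Scope classical_set_scope.
Local Open Scope ring_scope.

(* In a [metricType R], [ball z r] is the open ball [[set w | mdist z w < r]]
   (lemma [ballEmdist]); it is empty when [r <= 0]. *)

Section metric_notions.
Context {R : realType} {X : metricType R}.

(* The added value 0 makes [diam set0 = 0] (instead of -oo) and is harmless
   otherwise, distances being nonnegative. *)
Definition diam (A : set X) : \bar R :=
  ereal_sup ([set (mdist x y)%:E | x in A & y in A] `|` [set 0%E]).

Definition set_dist (E F : set X) : R := inf [set mdist x y | x in E & y in F].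

Definition relative_distance (E F : set X) : R :=
  set_dist E F / Num.min (fine (diam E)) (fine (diam F)).

Definition hausdorff_content (p delta : R) (A : set X) : \bar R :=
  ereal_inf [set (\sum_(0 <= i <oo) poweR (diam (F i)) p)%E |
    F in [set F : nat -> set X |
      A `<=` \bigcup_i F i /\ forall i, (diam (F i) <= delta%:E)%E]].

Definition hausdorff_measure (p : R) (A : set X) : \bar R :=
  lim (hausdorff_content p delta A @[delta --> 0^'+]).

(* Curves are identified with their images. *)
Definition is_curve (g : set X) : Prop :=
  exists (a b : R) (f : R -> X),
    [/\ a <= b, {within `[a, b], continuous f} & g = f @` `[a, b]].

Definition curves_joining (E F : set X) : set (set X) :=
  [set g | [/\ is_curve g, g `&` E !=set0 & g `&` F !=set0]].

Definition continuum (E : set X) : Prop := compact E /\ connected E.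

End metric_notions.

Section spaces.
Context {R : realType}.

Definition metrically_doubling (X : metricType R) : Prop :=
  exists2 D : nat, (1 <= D)%N &
    forall (z : X) (r : R), 0 < r ->
      exists2 s : seq X, (size s <= D)%N &
        ball z r `<=` \bigcup_(w in [set` s]) ball w (r / 2).

Definition LLC (X : metricType R) : Prop :=
  exists2 C : R, 1 <= C &
    forall x y : X, exists g : set X,
      [/\ is_curve g, g x, g y & (diam g <= (C * mdist x y)%:E)%E].

End spaces.

(* A collection of sets U with a chosen point z_U for each of them; the values
   of [center] outside [cells] are irrelevant. *)
Record pointed_collection (T : Type) := PointedCollection {
  cells : set (set T) ;
  center : set T -> T }.

Section approximations.
Context {R : realType} {X : metricType R}.
Implicit Type UU : pointed_collection X.

Definition radius UU (U : set X) : R := sup [set mdist (center UU U) x | x in U].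

Definition kappa_round (kappa : R) UU : Prop :=
  finite_set (cells UU) /\
  forall U, cells UU U ->
    [/\ open U, U (center UU U),
        ball (center UU U) (kappa^-1 * radius UU U) `<=` U
      & U `<=` ball (center UU U) (radius UU U)].

Definition kappa_approximation (kappa : R) UU : Prop :=
  [/\ kappa_round kappa UU,
      \bigcup_(U in cells UU) U = [set: X],
      trivIset (cells UU)
        (fun U => ball (center UU U) (kappa^-1 * radius UU U))
    & forall L : R, 1 <= L -> exists kappaL : R,
        forall U V, cells UU U -> cells UU V ->
          ball (center UU U) (L * radius UU U)
            `&` ball (center UU V) (L * radius UU V) !=set0 ->
          radius UU U <= kappaL * radius UU V].

Definition at_level (r : R) UU : Prop :=
  forall U, cells UU U -> radius UU U = r.

Definition admissible UU (Gamma : set (set X)) (rho : set X -> R) : Prop :=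
  (forall U, cells UU U -> 0 <= rho U) /\
  forall g, Gamma g ->
    1 <= \sum_(U \in [set U | cells UU U /\ U `&` g !=set0]) rho U.

Definition discrete_modulus (p : R) UU (Gamma : set (set X)) : \bar R :=
  ereal_inf [set (\sum_(U \in cells UU) powR (rho U) p)%:E |
    rho in admissible UU Gamma].

(* An increasing continuous function from (0, oo) to (0, oo); the values of [f]
   outside (0, oo) are irrelevant. *)
Definition increasing_gauge (f : R -> R) : Prop :=
  [/\ forall t, 0 < t -> 0 < f t,
      forall s t, 0 < s -> s < t -> f s < f t
    & {within `]0, +oo[, continuous f}].

(* The Loewner property of X with respect to a fixed sequence of
   approximations, [UU k] being meant to be at level 2 ^- k. *)
Definition combinatorially_loewner (p : R)
    (UU : nat -> pointed_collection X) : Prop :=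
  exists phi psi : R -> R,
    [/\ increasing_gauge phi, increasing_gauge psi,
        psi t @[t --> 0^'+] --> (0 : R),
        forall E F : set X, continuum E -> continuum F -> E `&` F = set0 ->
          forall k : nat, ((2 ^- k)%:E <= Order.min (diam E) (diam F))%E ->
          ((phi (relative_distance E F)^-1)%:E <=
             discrete_modulus p (UU k) (curves_joining E F))%E
      & forall (z : X) (r s : R), 0 < r -> r < s ->
          forall k : nat, 2 ^- k <= r ->
          (discrete_modulus p (UU k)
             (curves_joining (closure (ball z r)) (~` ball z s)) <=
           (psi (r / (s - r)))%:E)%E].

End approximations.

(* Main.v *)
Require Import Defs.
From HB Require Import structures.
From mathcomp Require Import all_boot all_order all_algebra finmap.
From mathcomp Require Import all_classical all_reals all_analysis.
From mathcomp Require Import lra ring.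
Import Order.TTheory GRing.Theory Num.Theory.
Import numFieldNormedType.Exports.
Local Open Scope classical_set_scope.
Local Open Scope ring_scope.

(* Near x there are continua E and F of diameter at least a = r/6 at mutual
   distance between a and 3a, so the Loewner lower bound keeps
   Mod(Gamma(E,F)) >= phi(1/3) at all fine levels. Cover a closed ball around E
   by finitely many balls B_i of small radii r_i; at a level finer than every
   r_i, the upper bound provides rho_i, of p-mass at most psi(1) + 1, admissible
   for the curves crossing the annulus 2 B_i \ B_i. Glue them into the l^p norm
   (over i) of the functions 14 (r_i / a) rho_i, each restricted to the cells
   meeting 2 B_i. Given a curve joining E and F, a Vitali selection of the B_i
   that it meets has pairwise disjoint 3 B_i, hence no cell is used twice, while
   the 7 B_i still cover a portion of the curve of diameter a; so the glued
   function is admissible, and phi(1/3) <= C * sum_i (r_i / a)^p. *)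

(** * Distance functions and subcurves *)

Lemma mdist_continuous {R : realType} {X : metricType R} (z : X) :
  continuous (mdist z : X -> R).
Proof.
move=> x; apply/cvgrPdist_lt => e e0.
have : \forall y \near x, ball x e y by exact: nbhsx_ballx.
apply: filterS => y; rewrite ballEmdist /= => xye.
have := metric_triangle z x y; have := metric_triangle z y x.
rewrite (metric_sym y x) ltr_norml => ? ?; apply/andP; split; lra.
Qed.

Lemma closed_ball_mdist {R : realType} {X : metricType R} (z : X) (r : R) :
  closed [set w | mdist z w <= r].
Proof.
have := (continuous_closedP (mdist z)).1 (mdist_continuous z) [set t | t <= r].
by apply; exact: closed_le.
Qed.

(** The times in [[s, u]] where [h] is at least [rho] form a nonempty compact set; [t] is its
    minimum, and the intermediate value theorem on [[s, t]] excludes [h t > rho]. *)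
Lemma first_hitting_time {R : realType} (h : R -> R) (s u rho : R) :
  s <= u -> {within `[s, u], continuous h} -> h s <= rho <= h u ->
  exists t, [/\ s <= t <= u, h t = rho & forall x, s <= x <= t -> h x <= rho].
Proof.
move=> su ch /andP[hs hu].
pose A := h @^-1` [set y | rho <= y].
have : closed (A : set (subspace `[s, u])).
  by move/continuous_closedP: ch; apply; exact: closed_ge.
move=> /closed_subspaceP[V cV VA].
have cA : compact (A `&` `[s, u]).
  rewrite -VA setIC.
  by rewrite -[X in X `&` _]setIid -setIA; apply: compact_closedI => //;
    [exact: segment_compact | apply: closedI => //; exact: interval_closed].
have A0 : A `&` `[s, u] !=set0.
  by exists u; split => //=; rewrite in_itv /= su lexx.
have cid : {within A `&` `[s, u], continuous (@id R)}.
  by apply: continuous_subspaceT => ?; exact: cvg_id.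
have [t] := compact_EVT_min A0 cA cid.
rewrite inE => -[rt /=]; rewrite in_itv /= => /andP[st tu] tmin.
have hlt x : s <= x -> x < t -> h x < rho.
  move=> sx xt; rewrite ltNge; apply/negP => rx.
  have /tmin : x \in A `&` `[s, u].
    by rewrite inE; split => //=; rewrite in_itv /= sx (le_trans (ltW xt)).
  by rewrite leNgt xt.
have ht : h t = rho.
  have [||c] := @IVT _ h s t rho st.
  - apply: continuous_subspaceW ch => x /=.
    by rewrite !in_itv /= => /andP[-> xt]; rewrite (le_trans xt).
  - by rewrite ge_min hs /= le_max rt orbT.
  rewrite in_itv /= => /andP[sc ct] hc.
  have [ct'|] := ltP c t; last by move=> tc; rewrite -hc; congr h; lra.
  by have := hlt c sc ct'; rewrite hc ltxx.
exists t; split; rewrite ?st//.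
move=> x /andP[sx]; rewrite le_eqVlt => /predU1P[->|/(hlt x sx)/ltW//].
by rewrite ht.
Qed.

Section curves.
Context {R : realType} {X : metricType R}.

(** An affine change of parameter runs from a time of [p] to a time of [q]; it may reverse
    direction, so the order of these times does not matter. *)
Lemma curve_between (g : set X) (p q : X) : is_curve g -> g p -> g q ->
  exists f : R -> X, [/\ {within `[0, 1], continuous f}, f 0 = p, f 1 = q &
    f @` `[0, 1] `<=` g].
Proof.
move=> [a [b [f [ab cf ->]]]] [s /= + <-] [u /= + <-].
rewrite !in_itv /= => /andP[as_ sb] /andP[au ub].
pose sg (t : R) : R := s + t * (u - s).
have csg : continuous sg.
  move=> t; apply: cvgD; first exact: cvg_cst.
  by apply: cvgM; [exact: cvg_id | exact: cvg_cst].
have sgI t : 0 <= t <= 1 -> a <= sg t <= b.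
  by move=> /andP[t0 t1]; rewrite /sg; apply/andP; split; nra.
exists (f \o sg); split.
- apply/subspace_continuousP => t; rewrite /= in_itv /= => t01.
  have /subspace_continuousP cf' := cf.
  apply: cvg_trans (cf' (sg t) _); last by rewrite /= in_itv /= sgI.
  move=> P H; have {}H : \forall y \near sg t, y \in `[a, b] -> P (f y) by [].
  have : \forall y \near t, sg y \in `[a, b] -> P (f (sg y)) := csg t _ H.
  by apply: filterS => y /= + y01; apply; rewrite in_itv /= sgI// -in_itv.
- by rewrite /sg /= mul0r addr0.
- by rewrite /sg /= mul1r addrC subrK.
- move=> w [t /=]; rewrite in_itv /= => t01 <-.
  by exists (sg t) => //=; rewrite in_itv /= sgI.
Qed.

(** Stopping at the first time on the sphere keeps the subcurve inside the closed ball. This serves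
    both to build small continua and to localize admissible functions. *)
Lemma subcurve_to_sphere (g : set X) (z p q : X) (rho : R) :
  is_curve g -> g p -> g q -> mdist z p <= rho <= mdist z q ->
  exists g' : set X, [/\ is_curve g', g' `<=` g, g' p,
    g' `<=` [set w | mdist z w <= rho] &
    exists2 w, g' w & mdist z w = rho].
Proof.
move=> cg gp gq; have [f [cf <- <- fg]] := curve_between g p q cg gp gq.
move=> H; have [|t [/andP[t0 t1] ft tl]] :=
  first_hitting_time (mdist z \o f) 0 1 rho ler01 _ H.
  by apply: within_continuous_comp cf => ? _; exact: mdist_continuous.
have sub : `[0, t] `<=` `[0, 1].
  by move=> x /=; rewrite !in_itv /= => /andP[-> xt]; rewrite (le_trans xt).
exists (f @` `[0, t]); split.
- by exists 0, t, f; split => //; exact: continuous_subspaceW cf.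
- by apply: subset_trans fg; exact: image_subset.
- by exists 0 => //=; rewrite in_itv /= lexx.
- by move=> w [x /= + <-]; rewrite in_itv /= => /tl.
- by exists (f t) => //; exists t => //=; rewrite in_itv /= t0 lexx.
Qed.

Lemma curve_continuum (g : set X) : is_curve g -> continuum g.
Proof.
move=> [a [b [f [ab cf ->]]]]; split.
  by apply: continuous_compact => //; exact: segment_compact.
by apply: connected_continuous_connected => //; exact: segment_connected.
Qed.

End curves.

(** * Vitali selection and length of covers *)

(** Greedy selection along a list sorted by increasing [rad]: the selection is made in the tail
    first, and the head, whose [rad] is smallest, is added only if it meets no selected set. *)
Lemma finite_vitali {R : realType} {T : Type} (B : nat -> set T)
    (rad : nat -> R) (s : seq nat) :
  uniq s -> (forall i, i \in s -> B i !=set0) ->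
  exists J : seq nat, [/\ uniq J, {subset J <= s}, trivIset [set` J] B &
    forall i, i \in s ->
      exists j, [/\ j \in J, rad i <= rad j & B i `&` B j !=set0]].
Proof.
set le := fun i j => rad i <= rad j.
have letot : total le by move=> i j; exact: le_total.
have letr : transitive le by move=> j i k; exact: le_trans.
have := sort_sorted letot s; rewrite -(sort_uniq le) => srt us Bs.
suff : forall s' : seq nat, uniq s' -> sorted le s' ->
    (forall i, i \in s' -> B i !=set0) -> exists J : seq nat, [/\ uniq J,
    {subset J <= s'}, trivIset [set` J] B & forall i, i \in s' ->
      exists j, [/\ j \in J, rad i <= rad j & B i `&` B j !=set0]].
  have Bs' i : i \in sort le s -> B i !=set0 by rewrite mem_sort; exact: Bs.
  move=> /(_ _ us srt Bs') [J [uJ Js tJ HJ]]; exists J; split => //.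
    by move=> i /Js; rewrite mem_sort.
  by move=> i; rewrite -(mem_sort le); exact: HJ.
elim=> [|i t IH] /=.
  by move=> _ _ _; exists [::]; split => // ? ?; rewrite inE.
move=> /andP[it ut] pt Bt.
have [||J [uJ Js tJ HJ]] := IH ut; first exact: path_sorted pt.
  by move=> j jt; apply: Bt; rewrite inE jt orbT.
have min_i := allP (order_path_min letr pt).
have [[j [jJ Bij]]|disj] :=
  pselect (exists j, j \in J /\ B i `&` B j !=set0).
  exists J; split => //.
    by move=> k /Js kt; rewrite inE kt orbT.
  move=> k; rewrite inE => /predU1P[->|/HJ//].
  by exists j; split => //; exact/min_i/Js.
exists (i :: J); split => /=.
- by rewrite uJ andbT; apply: contra it => /Js.
- by move=> k; rewrite !inE => /predU1P[->|/Js ->]; rewrite ?eqxx ?orbT.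
- move=> j k /=; rewrite !inE.
  move=> /predU1P[->|jJ] /predU1P[->|kJ]//; last exact: tJ.
    by move=> Bik; case: disj; exists k.
  by rewrite setIC => Bij; case: disj; exists j.
- move=> k; rewrite inE => /predU1P[->|/HJ[j [jJ kj Bkj]]].
    exists i; rewrite inE eqxx setIid; split => //.
    by apply: Bt; rewrite inE eqxx.
  by exists j; rewrite inE jJ orbT.
Qed.

Lemma length_le_cover {R : realType} (s : R) (J : seq nat) (c w : nat -> R) :
  uniq J -> (forall j, j \in J -> 0 <= w j) ->
  (forall t, 0 <= t < s -> exists2 j, j \in J & `|t - c j| <= w j) ->
  s <= \sum_(j <- J) 2 * w j.
Proof.
move=> uJ w0 cov.
have sub : `[0, s[ `<=` \bigcup_(j in [set` J])
      [set` `[c j - w j, c j + w j]].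
  move=> t /=; rewrite in_itv /= => /cov[j jJ]; rewrite ler_norml => H.
  by exists j => //=; rewrite in_itv /=; lra.
have [s0|s0] := ltP s 0.
  apply: (le_trans (ltW s0)); rewrite big_seq; apply: sumr_ge0 => j jJ.
  by rewrite mulr_ge0// w0.
have : (lebesgue_measure `[0%R, s[%classic <=
    \sum_(j <- J) lebesgue_measure `[(c j - w j)%R, (c j + w j)%R]%classic)%E.
  by rewrite fsbig_seq//; apply: content_sub_fsum => //; exact: finite_seq.
rewrite lebesgue_measure_itv /= lte_fin oppr0 adde0 => mle.
rewrite -lee_fin; apply: le_trans (le_trans mle _).
  by case: ltP s0 => //= s0 ?; rewrite lee_fin.
rewrite -sumEFin big_seq [leRHS]big_seq; apply: lee_sum => j jJ.
rewrite lebesgue_measure_itv /= lte_fin; have := w0 j jJ.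
case: ifPn => _ wj; rewrite -?EFinD lee_fin; lra.
Qed.

Lemma sum_disjoint_supports_le {R : realType} {I : choiceType} (J : seq I)
    (f : I -> R) (F : R) :
  uniq J -> 0 <= F -> (forall j, j \in J -> f j <= F) ->
  (forall i j, i \in J -> j \in J -> f i != 0 -> f j != 0 -> i = j) ->
  \sum_(j <- J) f j <= F.
Proof.
move=> uJ F0 fF disj.
have [[j [jJ fj]]|none] := pselect (exists j, j \in J /\ f j != 0).
  rewrite (bigD1_seq j)//= big_seq_cond big1 ?addr0 ?fF// => i /andP[iJ].
  by apply: contraNeq => fi; rewrite (disj _ _ iJ jJ).
rewrite big_seq big1// => j jJ; apply/eqP/negPn/negP => fj.
by apply: none; exists j.
Qed.

Lemma fsbig_set_and {R : realType} {T : choiceType} (A : set T) (Q : T -> Prop)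
    (f : T -> R) : finite_set A ->
  \sum_(U \in [set U | A U /\ Q U]) f U =
  \sum_(U <- fset_set A) if `[< Q U >] then f U else 0.
Proof.
move=> finA; rewrite -[X in \sum_(U \in X) _]/(A `&` Q) fsbig_mkcondr.
by rewrite fsbig_finite.
Qed.

(** The function [mdist p0] is 1-Lipschitz and maps [g] onto a set containing [[0, a]]. The images
    of the balls of radius [7 * r j], for [j] in the Vitali selection, lie in intervals of length
    [14 * r j] that cover [[0, a[]. *)
Lemma disjoint_balls_along_connected {R : realType} {X : metricType R}
    (g : set X) (p0 q0 : X) (a : R) (n : nat) (z : nat -> X) (r : nat -> R) :
  connected g -> g p0 -> g q0 -> a <= mdist p0 q0 ->
  (forall i, (i < n)%N -> 0 < r i) ->
  (forall w, g w -> mdist p0 w < a ->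
    exists2 i, (i < n)%N & ball (z i) (r i) w) ->
  exists J : seq nat, [/\ uniq J, forall j, j \in J -> (j < n)%N,
    trivIset [set` J] (fun i => ball (z i) (3 * r i)),
    forall j, j \in J -> ball (z j) (r j) `&` g !=set0 &
    a <= \sum_(j <- J) 14 * r j].
Proof.
move=> cg gp gq apq r0 cov.
pose s := [seq i <- iota 0 n | `[< ball (z i) (r i) `&` g !=set0 >]].
have sP i : i \in s <-> (i < n)%N /\ ball (z i) (r i) `&` g !=set0.
  rewrite mem_filter mem_iota leq0n add0n /=.
  split=> [/andP[/asboolP ? ?]|[? ?]]; first by split.
  by apply/andP; split => //; apply/asboolP.
have [||J [uJ Js tJ HJ]] :=
  finite_vitali (fun i => ball (z i) (3 * r i)) r s.
- by rewrite filter_uniq// iota_uniq.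
- move=> i /sP[/r0 ri _]; exists (z i); apply: ballxx; lra.
exists J; split => //.
- by move=> j /Js/sP[].
- by move=> j /Js/sP[].
rewrite (eq_bigr (fun j => 2 * (7 * r j))); last by move=> j _; ring.
apply: (length_le_cover a J (fun j => mdist p0 (z j))) => //.
  by move=> j /Js/sP[/r0 rj _]; lra.
move=> t /andP[t0 ta].
have [w gw wt] : exists2 w, g w & mdist p0 w = t.
  have /connected_intervalP itv : connected (mdist p0 @` g).
    apply: connected_continuous_connected => //.
    by apply: continuous_subspaceT; exact: mdist_continuous.
  have : (mdist p0 @` g) t.
    apply: (itv 0 (mdist p0 q0)).
    - by exists p0 => //; exact: mdistxx.
    - by exists q0.
    - by rewrite t0 (le_trans (ltW ta)).
  by move=> [w gw wt]; exists w.
have [|i ilt wi] := cov w gw; first by rewrite wt.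
have [|j [jJ rij [y []]]] := HJ i.
  by apply/sP; split => //; exists w.
move: wi; rewrite !ballEmdist /= => wi yi yj; exists j => //.
(* The path through [z i] and [y] has length at most [r i + 3 * r i + 3 * r j], and [r i <= r j]. *)
have wj : mdist w (z j) <= 7 * r j.
  have := metric_triangle w (z i) (z j); rewrite (metric_sym w (z i)).
  have := metric_triangle (z i) y (z j); rewrite (metric_sym y (z j)); lra.
have := metric_triangle p0 w (z j); have := metric_triangle p0 (z j) w.
rewrite (metric_sym (z j) w) wt ler_norml => ? ?; apply/andP; split; lra.
Qed.

(** * Bounding the discrete modulus by a cover with balls *)

Lemma discrete_modulus_lt {R : realType} {X : metricType R} (p M : R)
    (UU : pointed_collection X) (Gamma : set (set X)) :
  (discrete_modulus p UU Gamma < M%:E)%E ->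
  exists2 rho, admissible UU Gamma rho &
    \sum_(U \in cells UU) powR (rho U) p < M.
Proof.
by move=> /ereal_inf_lt[_ [rho adm <-]]; rewrite lte_fin; exists rho.
Qed.

(** The endpoints are too far apart to lie both in [ball z (2 * r)], so [g] contains a curve
    crossing the annulus. Cut at the sphere of radius [2 * r], that curve meets only cells that
    survive the restriction of [rho]. *)
Lemma admissible_near_ball {R : realType} {X : metricType R}
    (UU : pointed_collection X) (z : X) (r : R) (g : set X) (p0 q0 : X)
    (rho : set X -> R) :
  finite_set (cells UU) ->
  admissible UU (curves_joining (closure (ball z r)) (~` ball z (2 * r))) rho ->
  is_curve g -> g p0 -> g q0 -> 4 * r <= mdist p0 q0 ->
  ball z r `&` g !=set0 ->
  1 <= \sum_(U <- fset_set (cells UU)) if `[< U `&` g !=set0 >] then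
    if `[< U `&` [set w | mdist z w <= 2 * r] !=set0 >] then rho U else 0
    else 0.
Proof.
move=> fin [rho0 adm] cg gp gq pq [w [wz gw]].
have [q gq' zq] : exists2 q, g q & 2 * r <= mdist z q.
  have [|zp] := leP (2 * r) (mdist z p0); first by exists p0.
  exists q0 => //; have := metric_triangle p0 z q0.
  rewrite (metric_sym p0 z); lra.
have zw : mdist z w < r by move: wz; rewrite ballEmdist.
have := mdist_ge0 z w => zw0.
have [|g' [cg' g'g g'w g'b [v g'v zv]]] :=
  subcurve_to_sphere g z w q (2 * r) cg gw gq'.
  by apply/andP; split => //; lra.
have /adm : curves_joining (closure (ball z r)) (~` ball z (2 * r)) g'.
  split => //.
    by exists w; split => //; exact: subset_closure.
  by exists v; split => //; rewrite ballEmdist /= zv ltxx.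
rewrite fsbig_set_and// => /le_trans; apply.
rewrite big_seq [leRHS]big_seq; apply: ler_sum => U; rewrite in_fset_set// inE.
move=> /rho0 rU; case: asboolP => [[u [Uu g'u]]|_]; last by repeat case: ifP.
case: asboolP => [_|[]]; last by exists u; split => //; exact: g'g.
case: asboolP => // -[].
by exists u; split => //; exact: g'b.
Qed.

(** The test function is the pointwise l^p norm [F] of the weighted functions [f i]: it dominates
    each of them, while its p-mass is the sum of theirs. *)
Lemma discrete_modulus_le_cover {R : realType} {X : metricType R}
    (UU : pointed_collection X) (h p a M : R) (n : nat)
    (z : nat -> X) (r : nat -> R) (Gamma : set (set X)) :
  0 < p -> 0 < a -> finite_set (cells UU) ->
  (forall U, cells UU U -> U `<=` ball (Defs.center UU U) h) ->
  (forall i, (i < n)%N -> [/\ 0 < r i, h <= r i & 4 * r i <= a]) ->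
  (forall i, (i < n)%N -> (discrete_modulus p UU
     (curves_joining (closure (ball (z i) (r i))) (~` ball (z i) (2 * r i)))
     < M%:E)%E) ->
  (forall g, Gamma g -> is_curve g /\ exists p0 q0, [/\ g p0, g q0,
     a <= mdist p0 q0 & forall w, g w -> mdist p0 w < a ->
       exists2 i, (i < n)%N & ball (z i) (r i) w]) ->
  (discrete_modulus p UU Gamma
     <= (M * \sum_(i < n) powR (14 * r i / a) p)%:E)%E.
Proof.
move=> p0 a0 fin Uh rP modM GammaP.
have /choice[rho rhoP] : forall i, exists rho, (i < n)%N -> admissible UU
    (curves_joining (closure (ball (z i) (r i))) (~` ball (z i) (2 * r i))) rho
    /\ \sum_(U \in cells UU) powR (rho U) p < M.
  move=> i; have [ni|ni] := ltnP i n; last by exists (fun=> 0).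
  by have [rho ? ?] := discrete_modulus_lt _ _ _ _ (modM i ni); exists rho.
pose touches i U := `[< U `&` [set w | mdist (z i) w <= 2 * r i] !=set0 >].
pose f i U : R := 14 * r i / a * (if touches i U then rho i U else 0).
have c0 i : (i < n)%N -> 0 <= 14 * r i / a.
  by move=> /rP[ri _ _]; rewrite divr_ge0 ?mulr_ge0 ?ltW.
have f0 i U : (i < n)%N -> cells UU U -> 0 <= f i U.
  move=> ni cU; rewrite mulr_ge0 ?c0//; case: ifP => // _.
  by have [[rho0 _] _] := rhoP i ni; exact: rho0.
pose F U := powR (\sum_(i < n) powR (f i U) p) p^-1.
have fF i U : (i < n)%N -> cells UU U -> f i U <= F U.
  move=> ni cU.
  have -> : f i U = powR (powR (f i U) p) p^-1.
    by rewrite -powRrM mulfV ?gt_eqF// powRr1// f0.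
  apply: ge0_ler_powR; rewrite ?invr_ge0 ?nnegrE ?powR_ge0 ?(ltW p0)//.
    by apply: sumr_ge0 => j _; exact: powR_ge0.
  by rewrite (bigD1 (Ordinal ni))//= lerDl sumr_ge0// => j _; exact: powR_ge0.
apply: ge_ereal_inf; exists (\sum_(U \in cells UU) powR (F U) p)%:E.
  exists F => //; split=> [U _|g /GammaP[cg [q0 [q1 [gq0 gq1 aq cov]]]]].
    exact: powR_ge0.
  have [||J [uJ Jn tJ JB aJ]] :=
    disjoint_balls_along_connected g q0 q1 a n z r _ gq0 gq1 aq _ cov.
  - exact: (curve_continuum g cg).2.
  - by move=> i /rP[].
  rewrite fsbig_set_and//.
  (* The double sum over cells and [J] is read in two ways: for a fixed cell at most one [j]
     contributes, which gives at most [F U]; for a fixed [j] the cells contribute at least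
     [14 * r j / a], and these add up to at least 1. *)
  apply: (@le_trans _ _ (\sum_(U <- fset_set (cells UU))
    \sum_(j <- J) if `[< U `&` g !=set0 >] then f j U else 0)); last first.
    rewrite big_seq [leRHS]big_seq; apply: ler_sum => U.
    rewrite in_fset_set// inE => cU; case: asboolP => _; last first.
      by rewrite big1.
    apply: sum_disjoint_supports_le => //.
    + exact: powR_ge0.
    + by move=> j /Jn nj; exact: fF.
    (* A cell meeting both [2 B_i] and [2 B_j] has its center in
       [3 B_i] and [3 B_j], because [h <= r i] and [h <= r j]. *)
    move=> i j iJ jJ; rewrite /f.
    have centered k : k \in J -> touches k U ->
        ball (z k) (3 * r k) (Defs.center UU U).
      move=> /Jn/rP[_ hk _] /asboolP[u [Uu ku]].
      have := Uh U cU u Uu; rewrite !ballEmdist /= => cu.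
      have := metric_triangle (z k) u (Defs.center UU U).
      move: ku => /= ku; rewrite (metric_sym u); lra.
    case: ifPn => [iU _|_]; last by rewrite mulr0 eqxx.
    case: ifPn => [jU _|_]; last by rewrite mulr0 eqxx.
    by apply: tJ => //; exists (Defs.center UU U); split; exact: centered.
  rewrite exchange_big /=.
  apply: (@le_trans _ _ (\sum_(j <- J) 14 * r j / a)).
    by rewrite -mulr_suml ler_pdivlMr// mul1r.
  rewrite big_seq [leRHS]big_seq; apply: ler_sum => j jJ.
  have nj := Jn j jJ; have [rj hj ja] := rP j nj.
  have [adm _] := rhoP j nj.
  have := admissible_near_ball UU (z j) (r j) g q0 q1 (rho j) fin adm cg gq0
    gq1 (le_trans ja aq) (JB j jJ).
  move=> /(ler_wpM2l (c0 j nj)); rewrite mulr1 => /le_trans; apply.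
  rewrite mulr_sumr; apply: ler_sum => U _.
  by case: asboolP => _; rewrite ?mulr0.
(* It remains to bound the p-mass of [F]: the outer power cancels the root, and each [f i] has
   p-mass at most [powR (14 * r i / a) p * M]. *)
rewrite lee_fin fsbig_finite//=.
apply: (@le_trans _ _ (\sum_(U <- fset_set (cells UU))
    \sum_(i < n) powR (f i U) p)).
  apply: ler_sum => U _; rewrite /F -powRrM mulVf ?gt_eqF// powRr1//.
  by apply: sumr_ge0 => i _; exact: powR_ge0.
rewrite exchange_big /= mulr_sumr; apply: ler_sum => i _.
have [[rho0 _] mass] := rhoP i (ltn_ord i).
rewrite mulrC; apply: (@le_trans _ _ (powR (14 * r i / a) p *
    \sum_(U \in cells UU) powR (rho i U) p)); last first.
  by rewrite ler_wpM2l ?powR_ge0// ltW.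
rewrite fsbig_finite// mulr_sumr big_seq [leRHS]big_seq; apply: ler_sum => U.
rewrite in_fset_set// inE => cU; rewrite /f; case: ifPn => _.
  by rewrite powRM ?c0 ?rho0.
by rewrite mulr0 powR0 ?gt_eqF// mulr_ge0 ?powR_ge0.
Qed.

(** * Diameters and separated continua *)

Lemma mdist_le_diam {R : realType} {X : metricType R} (A : set X) (x y : X) :
  A x -> A y -> ((mdist x y)%:E <= diam A)%E.
Proof.
move=> Ax Ay; apply: ereal_sup_ubound; left.
by exists x => //; exists y.
Qed.

Lemma diam_le {R : realType} {X : metricType R} (A : set X) (c : R) :
  0 <= c -> (forall x y, A x -> A y -> mdist x y <= c) -> (diam A <= c%:E)%E.
Proof.
move=> c0 Ac; apply: ge_ereal_sup => _ [[x Ax [y Ay <-]]| ->].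
  by rewrite lee_fin Ac.
by rewrite lee_fin.
Qed.

Lemma exists_far_point {R : realType} {X : metricType R} (r : R) (x : X) :
  0 < r -> (r%:E < diam [set: X])%E -> exists y, r / 2 <= mdist x y.
Proof.
move=> r0; apply: contraPP => /forallNP near_x; apply/negP; rewrite -leNgt.
apply: diam_le; first exact: ltW.
move=> u v _ _; have := metric_triangle u x v; rewrite (metric_sym u x).
have /negP := near_x u; have /negP := near_x v; rewrite -!ltNge; lra.
Qed.

Lemma curve_from_center_to_sphere {R : realType} {X : metricType R}
    (x y : X) (rho : R) :
  LLC X -> 0 <= rho <= mdist x y ->
  exists E : set X, [/\ is_curve E, E x, E `<=` [set w | mdist x w <= rho] &
    exists2 w, E w & mdist x w = rho].
Proof.
move=> [C _ /(_ x y)[g [cg gx gy _]]] rhoxy.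
have [|E [cE _ Ex Esub Ew]] := subcurve_to_sphere g x x y rho cg gx gy.
  by rewrite mdistxx.
by exists E.
Qed.

(** [E] starts at [x] and [F] at a point [v] with [mdist x v = 3 * a]; each is a curve stopped at
    distance [a] from its start. Hence the gap is at least [a], and the pair [x], [v] bounds
    [set_dist] by [3 * a]. *)
Lemma exists_separated_continua {R : realType} {X : metricType R}
    (x y : X) (a : R) :
  LLC X -> 0 < a -> 3 * a <= mdist x y ->
  exists E F : set X, [/\ continuum E, continuum F,
    E `<=` [set w | mdist x w <= a],
    forall e f, E e -> F f -> a <= mdist e f &
    [/\ (a%:E <= diam E)%E, (a%:E <= diam F)%E &
     0 < relative_distance E F <= 3]].
Proof.
move=> llc a0 axy.
have [|E [cE Ex Ea [e Ee xe]]] :=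
  curve_from_center_to_sphere x y a llc; first lra.
have [|_ [_ _ _ [v _ xv]]] :=
  curve_from_center_to_sphere x y (3 * a) llc; first lra.
have [|F [cF Fv Fa [f Ff vf]]] := curve_from_center_to_sphere v x a llc.
  rewrite (metric_sym v x); lra.
have EF u w : E u -> F w -> a <= mdist u w.
  move=> /Ea /= xu /Fa /= vw.
  have := metric_triangle x u v; have := metric_triangle u w v.
  rewrite (metric_sym w v); lra.
have dE : (a%:E <= diam E)%E by rewrite -[X in X%:E]xe; exact: mdist_le_diam.
have dF : (a%:E <= diam F)%E by rewrite -[X in X%:E]vf; exact: mdist_le_diam.
have diam_center (A : set X) c : A `<=` [set w | mdist c w <= a] ->
    (diam A <= (2 * a)%:E)%E.
  move=> Ac; apply: diam_le => [|u w /Ac /= cu /Ac /= cw]; first lra.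
  have := metric_triangle u c w; rewrite (metric_sym u c); lra.
have fine_ge (A : set X) c : A `<=` [set w | mdist c w <= a] ->
    (a%:E <= diam A)%E -> a <= fine (diam A).
  move=> /diam_center; case: (diam A) => [d|//|//] _.
  by rewrite lee_fin.
exists E, F; split => //; try exact: curve_continuum.
split => //; have m_ge : a <= Num.min (fine (diam E)) (fine (diam F)).
  by rewrite le_min (fine_ge E x)// (fine_ge F v).
have m0 := lt_le_trans a0 m_ge.
have lbEF : lbound [set mdist u w | u in E & w in F] a.
  by move=> _ [u Eu [w Fw <-]]; exact: EF.
have sd_ge : a <= set_dist E F.
  by apply: lb_le_inf => //; exists (mdist x v), x => //; exists v.
have sd_le : set_dist E F <= 3 * a.
  rewrite -xv; apply: ge_inf; first by exists a.
  by exists x => //; exists v.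
rewrite /relative_distance ler_pdivrMr// divr_gt0//=; last lra.
by apply: (le_trans sd_le); rewrite ler_pM2l.
Qed.

(** * From Hausdorff measure to finite covers by balls *)

Lemma sum_halves_le {R : realType} (n : nat) :
  \sum_(i < n) (2 ^- i.+1 : R) <= 1.
Proof.
suff -> : \sum_(i < n) (2 ^- i.+1 : R) = 1 - 2 ^- n.
  by rewrite gerBl invr_ge0 exprn_ge0.
elim: n => [|n IH]; first by rewrite big_ord0 expr0 invr1 subrr.
rewrite big_ord_recr /= IH exprS invfM.
lra.
Qed.

Lemma open_ball_mdist {R : realType} {X : metricType R} (z : X) (r : R) :
  open (ball z r).
Proof.
rewrite ballEmdist.
have /continuousP := @mdist_continuous R X z.
by move=> /(_ [set t | t < r]); apply; exact: open_lt.
Qed.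

Lemma finite_ball_cover {R : realType} {X : metricType R} (x0 : X) (K : set X)
    (F : nat -> set X) (r : nat -> R) :
  compact K -> K `<=` \bigcup_i F i ->
  (forall i u v, F i u -> F i v -> mdist u v < r i) ->
  exists n (z : nat -> X), forall w, K w ->
    exists2 i, (i < n)%N & ball (z i) (r i) w.
Proof.
move=> /compact_near_coveringP cK KF Fr.
(* The default [x0] is taken only when [F i] is empty. *)
pose z i := xget x0 (F i).
have := cK nat \oo (fun n w => exists2 i, (i < n)%N & ball (z i) (r i) w) _ _.
case=> [w /KF[i _ Fw]|n _ /(_ n (leqnn n)) Kn]; last by exists n, z.
have wi : ball (z i) (r i) w.
  by rewrite ballEmdist; apply: (Fr i) => //; apply: xgetPex; exists w.
exists (ball (z i) (r i), [set n | (i < n)%N]) => /=.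
  split; last by exists i.+1.
  by apply: open_nbhs_nbhs; split => //; exact: open_ball_mdist.
by move=> [w' n] /= [iw' ni]; exists i.
Qed.

(** Each covering set lies in an open ball of radius about twice its diameter, and compactness of
    [K] leaves finitely many balls. The doubling costs the factor [powR 2 p], and the extra radii
    cost half of [B]. *)
Lemma hausdorff_content_ge {R : realType} {X : metricType R} (x0 : X)
    (p delta B : R) (K A : set X) :
  0 < p -> 0 < delta -> 0 < B -> compact K -> K `<=` A ->
  (forall n (z : nat -> X) (r : nat -> R),
     (forall i, (i < n)%N -> 0 < r i <= 2 * delta) ->
     (forall w, K w -> exists2 i, (i < n)%N & ball (z i) (r i) w) ->
     B <= \sum_(i < n) powR (r i) p) ->
  ((B / (2 * powR 2 p))%:E <= hausdorff_content p delta A)%E.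
Proof.
move=> p0 d0 B0 cK KA ballB.
apply: le_ereal_inf_tmp => _ [F [AF Fd] <-].
pose d i := fine (diam (F i)).
have dE i : diam (F i) = (d i)%:E.
  rewrite /d fineK// fin_numElt (le_lt_trans (Fd i)) ?ltry// andbT.
  by apply: lt_le_trans (ltNyr 0) _; apply: ereal_sup_ubound; right.
have d_ge0 i : 0 <= d i.
  by rewrite -lee_fin -dE; apply: ereal_sup_ubound; right.
have d_le i : d i <= delta by rewrite -lee_fin -dE.
(* The summable [e i] keep the radii positive where [diam (F i) = 0]. *)
pose e i := Num.min delta (powR (B / 2 * 2 ^- i.+1) p^-1).
have e0 i : 0 < e i.
  by rewrite lt_min d0 powR_gt0// mulr_gt0 ?divr_gt0 ?invr_gt0 ?exprn_gt0.
have ep i : powR (e i) p <= B / 2 * 2 ^- i.+1.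
  have c0 : 0 <= B / 2 * 2 ^- i.+1.
    by rewrite mulr_ge0 ?divr_ge0 ?invr_ge0 ?exprn_ge0 ?ltW.
  have -> : B / 2 * 2 ^- i.+1 = powR (powR (B / 2 * 2 ^- i.+1) p^-1) p.
    by rewrite -powRrM mulVf ?gt_eqF// powRr1.
  apply: ge0_ler_powR; rewrite ?nnegrE ?powR_ge0 ?(ltW p0) ?(ltW (e0 i))//.
  by rewrite ge_min lexx orbT.
(* In either case [d i < r i], so the open ball of radius [r i] about any point of [F i] contains
   [F i]. *)
pose r i := Num.max (2 * d i) (e i).
have [|i u v Fu Fv|n [z KB]] := finite_ball_cover x0 K F r cK.
- exact: subset_trans KA AF.
- have : mdist u v <= d i by rewrite -lee_fin -dE; exact: mdist_le_diam.
  by rewrite /r lt_max; have := e0 i; case: (ltP 0 (d i)) => ? ? ?;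
    apply/orP; [left|right]; lra.
have rB : B <= \sum_(i < n) powR (r i) p.
  apply: ballB KB => i _; rewrite /r lt_max (e0 i) orbT /= ge_max.
  rewrite ler_pM2l// d_le /= ge_min; apply/orP; left; lra.
have rp i : powR (r i) p <= powR 2 p * powR (d i) p + B / 2 * 2 ^- i.+1.
  rewrite /r -powRM//; have [_|_] := leP (2 * d i) (e i).
    by apply: le_trans (ep i) _; rewrite lerDr powR_ge0.
  by rewrite lerDl (le_trans (powR_ge0 _ _) (ep i)).
have sumB : B / 2 <= powR 2 p * \sum_(i < n) powR (d i) p.
  have : B <= \sum_(i < n) (powR 2 p * powR (d i) p + B / 2 * 2 ^- i.+1).
    by apply: le_trans rB _; apply: ler_sum => i _; exact: rp.
  rewrite big_split /= -!mulr_sumr => BB.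
  have := ler_wpM2l (ltW (divr_gt0 B0 (ltr0Sn R 1))) (@sum_halves_le R n).
  lra.
apply: le_trans (nneseries_lim_ge n _); last by move=> i _ _; exact: poweR_ge0.
under eq_bigr do rewrite dE poweR_EFin.
rewrite sumEFin lee_fin big_mkord invfM mulrA ler_pdivrMr ?powR_gt0//.
by rewrite [leRHS]mulrC.
Qed.

(** The content grows as [delta] decreases, so its limit at 0 exists and dominates every value. *)
Lemma hausdorff_measure_ge {R : realType} {X : metricType R} (p c delta : R)
    (A : set X) :
  0 < delta -> (c%:E <= hausdorff_content p delta A)%E ->
  (c%:E <= hausdorff_measure p A)%E.
Proof.
move=> d0 cA.
have mono (s t : R) : s <= t ->
    (hausdorff_content p t A <= hausdorff_content p s A)%E.
  move=> st; apply: ereal_inf_le_tmp => _ [F [AF Fs] <-].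
  exists F => //; split => // i.
  by apply: le_trans (Fs i) _; rewrite lee_fin.
apply: lime_ge.
  apply: nonincreasing_at_right_is_cvge; near=> t => s u _ _ su.
  exact: mono.
near=> t; apply: le_trans cA (mono _ _ _); near: t.
exact: nbhs_right_le.
Unshelve. all: by end_near. Qed.

(** * Lower bound for ball covers and conclusion *)

Lemma exists_common_lower_bound {R : realType} (n : nat) (a : R)
    (r : nat -> R) :
  0 < a -> (forall i, (i < n)%N -> 0 < r i) ->
  exists m, [/\ 0 < m, m <= a & forall i, (i < n)%N -> m <= r i].
Proof.
move=> a0; elim: n => [|n IH] r0; first by exists a.
have [|m [m0 ma mr]] := IH; first by move=> i /ltnW; exact: r0.
exists (Num.min m (r n)); split; first by rewrite lt_min m0 r0.
  by rewrite ge_min ma.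
move=> i; rewrite ltnS leq_eqVlt ge_min => /predU1P[->|/mr ->//].
by rewrite lexx orbT.
Qed.

(** The level [k] is chosen after the finite cover, finer than all its radii; since [phi0] and [M]
    do not depend on [k], the resulting bound does not depend on the cover. *)
Lemma ball_cover_sum_ge {R : realType} {X : metricType R} (p a phi0 M : R)
    (UU : nat -> pointed_collection X) (E F : set X) (x : X)
    (n : nat) (z : nat -> X) (r : nat -> R) :
  0 < p -> 0 < a -> 0 < M ->
  (forall k, finite_set (cells (UU k)) /\ forall U, cells (UU k) U ->
     U `<=` ball (Defs.center (UU k) U) (2 ^- k)) ->
  (forall k z s, 0 < s -> 2 ^- k <= s -> (discrete_modulus p (UU k)
     (curves_joining (closure (ball z s)) (~` ball z (2 * s))) < M%:E)%E) ->
  (forall k, 2 ^- k <= a ->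
     (phi0%:E <= discrete_modulus p (UU k) (curves_joining E F))%E) ->
  E `<=` [set w | mdist x w <= a] ->
  (forall e f, E e -> F f -> a <= mdist e f) ->
  (forall i, (i < n)%N -> 0 < r i /\ 4 * r i <= a) ->
  (forall w, mdist x w <= 2 * a ->
     exists2 i, (i < n)%N & ball (z i) (r i) w) ->
  phi0 / (M * powR (14 / a) p) <= \sum_(i < n) powR (r i) p.
Proof.
move=> p0 a0 M0 UUP annuli phiE Ea EF rP cov.
have [m [m0 ma mr]] := exists_common_lower_bound n a r a0
  (fun i ni => (rP i ni).1).
have [k _ /(_ k (leqnn k)) km] := near_infty_natSinv_expn_lt (PosNum m0).
have {}km : 2 ^- k <= m by rewrite -div1r ltW.
have ka := le_trans km ma.
have kr i : (i < n)%N -> 2 ^- k <= r i by move=> /mr; exact: le_trans.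
have [fin Uk] := UUP k.
have := discrete_modulus_le_cover (UU k) (2 ^- k) p a M n z r
  (curves_joining E F) p0 a0 fin Uk.
have rk i : (i < n)%N -> [/\ 0 < r i, 2 ^- k <= r i & 4 * r i <= a].
  by move=> ni; have [? ?] := rP i ni; split => //; exact: kr.
move=> /(_ rk) H; have {H} : (discrete_modulus p (UU k) (curves_joining E F)
    <= (M * \sum_(i < n) powR (14 * r i / a) p)%:E)%E.
  apply: H => [i /rk[r0 kri _]|g [cg [e [ge Ee]] [f [gf Ff]]]].
    exact: annuli.
  split => //; exists e, f; split => //; first exact: EF.
  move=> w _ ew; apply: cov; have := metric_triangle x e w.
  by have /= := Ea e Ee; lra.
move=> /(le_trans (phiE k ka)); rewrite lee_fin => phiM.
rewrite ler_pdivrMr; last by rewrite mulr_gt0// powR_gt0// divr_gt0.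
apply: le_trans phiM _; rewrite mulrCA mulr_suml ler_pM2l//.
apply: ler_sum => i _; have [r0 _] := rP i (ltn_ord i).
rewrite -powRM ?(ltW r0)//; last by rewrite ltW// divr_gt0.
by rewrite mulrCA mulrA.
Qed.

Theorem proposition4p9 (R : realType) (X : metricType R) (p kappa : R)
    (UU : nat -> pointed_collection X)
    (hp : 1 < p) (hkappa : 1 <= kappa)
    (hUU : forall k : nat,
       kappa_approximation kappa (UU k) /\ at_level (2 ^- k) (UU k))
    (hcompact : compact [set: X]) (hLLC : LLC X)
    (hdoubling : metrically_doubling X)
    (hLoewner : combinatorially_loewner p UU) :
  exists2 C : R, 0 < C &
    forall (r : R) (x : X), 0 < r -> (r%:E < diam [set: X])%E ->
      ((C * powR r p)%:E <= hausdorff_measure p (ball x r))%E.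
Proof.
have [phi [psi [[phi0 phi_incr _] [psi0 _ _] _ lower upper]]] := hLoewner.
have p0 : 0 < p by lra.
pose phi3 := phi 3^-1; have phi3_gt0 : 0 < phi3 by exact: phi0.
(* The argument 1 is [t / (2 * t - t)]; adding 1 makes the modulus bound strict, so that an
   admissible function of p-mass below [M] exists. *)
pose M := psi 1 + 1; have M0 : 0 < M by rewrite addr_gt0// psi0.
(* With [a = r / 6], [14 / a] equals [84 / r]; the last divisor is the loss in
   [hausdorff_content_ge]. *)
exists (phi3 / (M * powR 84 p) / (2 * powR 2 p)).
  by rewrite !divr_gt0 ?mulr_gt0 ?powR_gt0.
(* This choice gives [3 * a = r / 2], the distance guaranteed by [exists_far_point], and
   [2 * a < r], so the closed ball of radius [2 * a] lies in [ball x r]. *)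
move=> r x r0 rX; pose a := r / 6; have a0 : 0 < a by rewrite /a; lra.
have [y xy] := exists_far_point r x r0 rX.
have [|E [F [cE cF Ea EF [aE aF /andP[D0 D3]]]]] :=
  exists_separated_continua x y a hLLC a0; first by rewrite /a; lra.
have -> : phi3 / (M * powR 84 p) / (2 * powR 2 p) * powR r p =
    phi3 / (M * powR (14 / a) p) / (2 * powR 2 p).
  have -> : powR 84 p = powR (14 / a) p * powR r p.
    rewrite -powRM ?ltW ?divr_gt0//; congr powR; rewrite /a; field; lra.
  field; rewrite !gt_eqF ?powR_gt0 ?divr_gt0//.
(* At scale [a / 8] the covering balls have radius at most [a / 4], as the annuli require. *)
apply: (@hausdorff_measure_ge _ _ _ _ (a / 8)); first by rewrite divr_gt0.
apply: (hausdorff_content_ge x p (a / 8) _ [set w | mdist x w <= 2 * a]) => //.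
- by rewrite divr_gt0.
- by rewrite divr_gt0// mulr_gt0// powR_gt0// divr_gt0.
- by apply: subclosed_compact hcompact _ => //; exact: closed_ball_mdist.
- by move=> w /=; rewrite ballEmdist /= /a; lra.
move=> n z s sP cov.
apply: (@ball_cover_sum_ge _ _ _ _ _ _ UU E F x _ z) => //.
- move=> k; have [[[fin round] _ _ _] lev] := hUU k; split => // U cU.
  by rewrite -(lev U cU); have [] := round U cU.
- move=> k w t t0 kt; apply: (@le_lt_trans _ _ (psi (t / (2 * t - t)))%:E).
    by apply: upper => //; lra.
  rewrite (_ : t / (2 * t - t) = 1) ?lte_fin ?ltrDl//.
  field; lra.
- move=> k ka.
  have disj : E `&` F = set0.
    apply/eqP/negPn/negP => /set0P[w [Ew Fw]].
    by have := EF w w Ew Fw; rewrite mdistxx; lra.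
  apply: le_trans (lower E F cE cF disj k _).
    rewrite lee_fin /phi3; move: D3; rewrite le_eqVlt => /predU1P[->//|D3].
    by apply/ltW/phi_incr => //; rewrite ltf_pV2// posrE.
  have ka' : ((2 ^- k)%:E <= a%:E)%E by rewrite lee_fin.
  by rewrite le_min !(le_trans ka').
- by move=> i /sP; lra.
Qed.
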